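(* Let $\Gamma$ be a finite simple connected graph with $d+1$ distinct eigenvalues and predistance polynomials $p_i$, $i=0,1,\ldots,d$. (a) If $p_i$ is monic for every $i=1,\ldots,d-1$, then $\Gamma$ is distance-regular. (b) If $\Gamma$ is bipartite and all the polynomials $p_i$ are monic, then $\Gamma$ is distance-regular.
   Context: Let $A$ be the adjacency matrix of $\Gamma$, $n$ the number of vertices, $\lambda_0>\lambda_1>\cdots>\lambda_d$ the distinct eigenvalues of $A$, and $m_0,\ldots,m_d$ their multiplicities. The predistance polynomials $p_0,\ldots,p_d\in\mathbb{R}[x]$ are the unique polynomials with $\deg p_i=i$ that are orthogonal with respect to $\langle f,g\rangle_\Gamma=\frac1n\operatorname{tr}(f(A)g(A))=\frac1n\sum_{i=0}^d m_i f(\lambda_i)g(\lambda_i)$ and normalized so that $\|p_i\|_\Gamma^2=p_i(\lambda_0)$. A polynomial $p_i$ of degree $i$ is monic if its coefficient of $x^i$ equals $1$. A connected graph is distance-regular if for all integers $h,i,j\ge 0$ and any two vertices $u,v$ at distance $h$, the number of vertices at distance $i$ from $u$ and distance $j$ from $v$ depends only on $h,i,j$. *)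

(* Defs.v *)
From mathcomp Require Import all_boot all_order all_algebra.
From mathcomp Require Import reals.

Set Implicit Arguments.
Unset Strict Implicit.
Unset Printing Implicit Defensive.

Import Order.TTheory GRing.Theory Num.Theory.
Local Open Scope ring_scope.

Definition simple_graph (T : finType) (e : rel T) : Prop :=
  symmetric e /\ irreflexive e.

Definition connected_graph (T : finType) (e : rel T) : Prop :=
  (0 < #|T|)%N /\ forall x y : T, connect e x y.

Definition bipartite (T : finType) (e : rel T) : Prop :=
  exists c : T -> bool, forall x y : T, e x y -> c x != c y.

Definition walk (T : finType) (e : rel T) (k : nat) (x y : T) : bool :=
  [exists s : k.-tuple T, path e x s && (last x s == y)].

(* Least length of a walk from x to y. A shortest walk repeats no vertex, so
   lengths below #|T| suffice; the value is #|T| when y is unreachable. *)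
Definition gdist (T : finType) (e : rel T) (x y : T) : nat :=
  find (fun k => walk e k x y) (iota 0 #|T|).

Definition distance_regular (T : finType) (e : rel T) : Prop :=
  connected_graph e /\
  forall (h i j : nat) (u v u' v' : T),
    gdist e u v = h -> gdist e u' v' = h ->
    #|[set w | (gdist e u w == i) && (gdist e v w == j)]| =
    #|[set w | (gdist e u' w == i) && (gdist e v' w == j)]|.

Definition adjmx (R : realType) (T : finType) (e : rel T) : 'M[R]_#|T| :=
  \matrix_(i, j) (e (enum_val i) (enum_val j))%:R.

(* f(A). The library's [horner_mx] is restricted to sizes of the syntactic
   form n.+1, hence is not applicable at size #|T|; see [mx_evalE]. *)
Definition mx_eval (R : realType) (n : nat) (A : 'M[R]_n) (f : {poly R}) :
  'M[R]_n := \sum_(k < size f) f`_k *: (A ^+ k).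

Lemma mx_evalE (R : realType) (n : nat) (A : 'M[R]_n.+1) (f : {poly R}) :
  mx_eval A f = horner_mx A f.
Proof.
rewrite -[in RHS](coefK f) poly_def rmorph_sum /=.
apply: eq_bigr => k _.
by rewrite linearZ /= rmorphXn /= horner_mx_X.
Qed.

Definition graph_inner (R : realType) (T : finType) (e : rel T)
    (f g : {poly R}) : R :=
  (#|T|%:R)^-1 * \tr (mx_eval (adjmx R e) f *m mx_eval (adjmx R e) g).

Definition distinct_eigenvalues (R : realType) (T : finType) (e : rel T)
    (d : nat) (lambda : 'I_d.+1 -> R) : Prop :=
  (forall i j : 'I_d.+1, (i < j)%N -> lambda j < lambda i) /\
  (forall a : R, eigenvalue (adjmx R e) a <-> exists i, a = lambda i).

Definition predistance_polynomials (R : realType) (T : finType) (e : rel T)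
    (d : nat) (lambda : 'I_d.+1 -> R) (p : 'I_d.+1 -> {poly R}) : Prop :=
  [/\ forall i : 'I_d.+1, size (p i) = i.+1,
      forall i j : 'I_d.+1, i != j -> graph_inner e (p i) (p j) = 0
    & forall i : 'I_d.+1, graph_inner e (p i) (p i) = (p i).[lambda ord0]].

(* Main.v *)
Require Import Defs.
From mathcomp Require Import all_boot all_order all_algebra.
From mathcomp Require Import reals.
From mathcomp Require Import ring.
From mathcomp Require complex spectral.
Import Order.TTheory GRing.Theory Num.Theory.
Local Open Scope ring_scope.

Set Implicit Arguments.
Unset Strict Implicit.
Unset Printing Implicit Defensive.

(** Part (b) is an instance of part (a). For (a), the case [d <= 1] is a
    complete graph (or a point), where the powers [1] and ['X] already do what
    the predistance polynomials do below; so let [d >= 2], write [A] for the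
    adjacency matrix and [D i] for the matrix of the relation of being at
    distance [i].

    As [p_0 = 1], orthogonality forces [p_1 = 'X] when [p_1] is monic. Its
    normalization then says that the average valency is the largest eigenvalue
    [lambda_0]. A Rayleigh quotient argument makes the all-one vector an
    eigenvector, so the graph is regular ([predistance1_regular]).

    The main step ([predistance_distmx]) shows [p_i(A) = D i] for [i < d] by
    induction on [i]. Entries of [p_i(A)] at distance greater than [i] are [0];
    those at distance [j < i] have sum [0], by orthogonality to [p_j(A) = D j].
    The normalization of [p_i] says that the sum of all entries equals the sum
    of their squares. So the entries at distance [i], which are numbers of
    shortest paths since [p_i] is monic, add up to the sum of all squares. A
    positive integer is at most its square, so equality holds everywhere: the
    entries at distance [i] are [1] and all others are [0].

    Finally, the product [q] of the ['X - lambda_i] with [i > 0] has degree [d]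
    and, by regularity and connectedness, [q(A)] is a nonzero multiple of the
    all-one matrix ([hoffman_polynomial]). Hence [p_0, ..., p_(d-1), q] is a
    basis of the polynomials of degree at most [d], to which every polynomial
    in [A] reduces, and all its members are constant on pairs of vertices at a
    given distance. Also [D d], the all-one matrix minus the other [D i], is a
    polynomial in [A]. So the entries of the products [D i *m D j], which are
    the intersection numbers, depend on the distance only
    ([distance_regular_of_algebra]). *)

(** * Polynomials evaluated at square matrices *)

Section MatrixEvaluation.
Variables (R : realType) (n : nat) (A : 'M[R]_n).
Implicit Types f g : {poly R}.

(** [horner_mx] evaluates at matrices of size [n.+1]; at size [0] all matrices
    are equal. *)
Lemma mx_evalD f g : mx_eval A (f + g) = mx_eval A f + mx_eval A g.
Proof.
case: n A => [|k] B; first by apply/matrixP => -[].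
by rewrite !mx_evalE rmorphD.
Qed.

Lemma mx_evalZ a f : mx_eval A (a *: f) = a *: mx_eval A f.
Proof.
case: n A => [|k] B; first by apply/matrixP => -[].
by rewrite !mx_evalE linearZ.
Qed.

Lemma mx_evalM f g : mx_eval A (f * g) = mx_eval A f *m mx_eval A g.
Proof.
case: n A => [|k] B; first by apply/matrixP => -[].
by rewrite !mx_evalE rmorphM.
Qed.

Lemma mx_eval0 : mx_eval A 0 = 0.
Proof. by rewrite -(scale0r 0) mx_evalZ scale0r. Qed.

Lemma mx_evalC a : mx_eval A a%:P = a%:M.
Proof.
case: n A => [|k] B; first by apply/matrixP => -[].
by rewrite mx_evalE horner_mx_C.
Qed.

Lemma mx_evalX : mx_eval A 'X = A.
Proof.
case: n A => [|k] B; first by apply/matrixP => -[].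
by rewrite mx_evalE horner_mx_X.
Qed.

Lemma mx_evalXn k : mx_eval A 'X^k = A ^+ k.
Proof.
case: n A => [|m] B; first by apply/matrixP => -[].
by rewrite mx_evalE rmorphXn /= horner_mx_X.
Qed.

Lemma mx_eval_sum (I : finType) (P : pred I) (F : I -> {poly R}) :
  mx_eval A (\sum_(i | P i) F i) = \sum_(i | P i) mx_eval A (F i).
Proof. exact: (big_morph _ mx_evalD mx_eval0). Qed.

Lemma mx_eval_sym f : A^T = A -> (mx_eval A f)^T = mx_eval A f.
Proof.
move=> symA; rewrite /mx_eval linear_sum /=; apply: eq_bigr => k _.
rewrite linearZ /=; congr (_ *: _).
case: n A symA => [|m] B symB; first by apply/matrixP => -[].
elim: (k : nat) => [|j IHj]; first by rewrite expr0 trmx1.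
by rewrite {1}exprS -mulmxE trmx_mul IHj symB mulmxE -exprSr.
Qed.

Lemma mx_eval_eigenvector f a (x : 'cV_n) :
  A *m x = a *: x -> mx_eval A f *m x = f.[a] *: x.
Proof.
move=> Ax; elim/poly_ind: f => [|f c IHf].
  by rewrite mx_eval0 mul0mx horner0 scale0r.
rewrite hornerMXaddC mx_evalD mx_evalM mx_evalX mx_evalC mulmxDl -mulmxA Ax.
by rewrite -scalemxAr IHf mul_scalar_mx scalerDl scalerA mulrC.
Qed.

End MatrixEvaluation.

(** * Spectral theory of real symmetric matrices *)

Section RealSymmetric.
Import complex spectral.
Local Notation "M ^t*" := (map_mx Num.conj M^T) (at level 30).
Local Notation toC := (real_complex _).

(** The spectral theorem for Hermitian matrices, applied to the
    complexification of [A]: the eigenvalues it provides are real, hence they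
    are eigenvalues of [A] itself. *)
Lemma real_symmetric_spectral (R : realType) (n : nat) (A : 'M[R]_n) :
  A^T = A ->
  exists P : 'M[R[i]]_n, exists D : 'rV[R]_n,
    [/\ P *m P^t* = 1%:M, P^t* *m P = 1%:M,
        forall i, eigenvalue A (D 0 i)
      & map_mx toC A = P^t* *m diag_mx (map_mx toC D) *m P].
Proof.
move=> symA; set AC := map_mx toC A.
have realA : AC \is a mxOver Num.real.
  apply/mxOverP => i j; rewrite mxE; apply/complex_realP.
  by exists (A i j).
have hermA : AC \is hermsymmx.
  apply: realsym_hermsym => //; rewrite qualifE /= expr0 scale1r.
  by rewrite map_mx_id // map_trmx symA.
have /orthomx_spectralP := hermitian_normalmx hermA.
have := hermitian_spectral_diag_real hermA.
have := spectral_unitarymx AC.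
set P := spectralmx AC; set E := spectral_diag AC => unitP realE.
rewrite invmx_unitary // => eqA.
have PPt : P *m P^t* = 1%:M by apply/unitarymxP.
exists P, (map_mx (@complex.Re _) E).
have Ei i : toC (complex.Re (E 0 i)) = E 0 i by apply: RRe_real; apply/mxOverP.
split=> //; first exact: mulmx1C.
- move=> i; rewrite eigenvalue_root_char.
  rewrite -(fmorph_root toC) map_char_poly -eigenvalue_root_char mxE.
  suff: eigenvalue AC (E 0 i) by rewrite -Ei.
  apply/eigenvalueP; exists (row i P).
    rewrite eqA -!row_mul !mulmxA PPt mul1mx row_mul row_diag_mx.
    by rewrite -scalemxAl -rowE.
  apply/eqP => P0; have := congr1 (fun M => row i M) PPt.
  rewrite row_mul P0 mul0mx => /rowP /(_ i); rewrite !mxE eqxx => /eqP.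
  by rewrite eq_sym oner_eq0.
- suff -> : map_mx toC (map_mx (@complex.Re _) E) = E by [].
  by apply/rowP => i; rewrite !mxE; exact: Ei.
Qed.

(** Real symmetric matrices are diagonalizable, so it is enough that [f]
    vanishes at each eigenvalue, whatever its multiplicity. *)
Lemma symmetric_annihilated (R : realType) (n : nat) (A : 'M[R]_n) f :
  A^T = A -> (forall a, eigenvalue A a -> root f a) -> mx_eval A f = 0.
Proof.
case: n A => [|n] A symA rootf; first by apply/matrixP => -[].
have [P [D [PPt PtP eigD eqA]]] := real_symmetric_spectral symA.
have unitP : P \is a GRing.unit by case/mulmx1_unit: PPt.
have invP : invmx P = P^t*.
  by rewrite -[RHS]mul1mx -(mulVmx unitP) -mulmxA PPt mulmx1.
apply: (map_mx_inj (f := toC)); rewrite map_mx0 mx_evalE map_horner_mx eqA.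
rewrite -invP horner_mx_uconjC // horner_mx_diag.
suff -> : map_mx (horner (map_poly toC f)) (map_mx toC D) = 0.
  by rewrite linear0 mulmx0 mul0mx.
apply/rowP => i; rewrite !mxE horner_map /=.
by move/rootP: (rootf _ (eigD i)) => ->; rewrite rmorph0.
Qed.

(** In an orthonormal eigenbasis, [x^T (a - A) x] is the sum of the nonnegative
    numbers [(a - a_i) |y_i|^2], [y] being the vector of coordinates of [x]. *)
Lemma symmetric_max_rayleigh (R : realType) (n : nat) (A : 'M[R]_n)
    (a : R) (x : 'cV_n) :
  A^T = A -> (forall b, eigenvalue A b -> b <= a) ->
  x^T *m A *m x = a *: (x^T *m x) -> A *m x = a *: x.
Proof.
move=> symA maxa eqx.
have [P [D [PPt PtP eigD eqA]]] := real_symmetric_spectral symA.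
set xC := map_mx toC x; set y := P *m xC.
set E := map_mx toC (const_mx a - D).
have eqE : toC a *: 1%:M - map_mx toC A = P^t* *m diag_mx E *m P.
  rewrite eqA /E map_mxB raddfB /= mulmxBr mulmxBl; congr (_ - _).
  rewrite map_const_mx diag_const_mx.
  by rewrite mul_mx_scalar -scalemxAl PtP.
have xCt : xC^t* = map_mx toC x^T.
  by apply/matrixP => i j; rewrite !mxE; exact: conjc_real.
have quad0 : y^t* *m diag_mx E *m y = 0.
  rewrite /y trmx_mul map_mxM /= !mulmxA -[_ *m diag_mx E]mulmxA.
  rewrite -[_ *m P]mulmxA -[_ *m _ *m P]mulmxA !mulmxA.
  rewrite -![xC^t* *m _ *m _]mulmxA -eqE xCt.
  rewrite -(map_mx1 toC) -map_mxZ -map_mxB -!map_mxM.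
  rewrite mulmxBl mulmxBr -scalemxAl mul1mx -scalemxAr.
  rewrite [x^T *m (A *m x)]mulmxA eqx subrr.
  exact: map_mx0.
have E_ge0 i : 0 <= E 0 i.
  rewrite !mxE /= lecE /= eqxx subr_ge0; exact: maxa.
have term j : (y^t* *m diag_mx E) 0 j * y j 0 = E 0 j * `|y j 0| ^+ 2.
  rewrite mul_mx_diag normCKC mulrA [E 0 j * _]mulrC; congr (_ * _).
  by rewrite mxE; congr (_ * _); rewrite !mxE.
have Ey i : E 0 i * y i 0 = 0.
  move/matrixP: quad0 => /(_ 0 0); rewrite mxE [RHS]mxE => /eqP.
  rewrite (eq_bigr _ (fun j _ => term j)) psumr_eq0; last first.
    by move=> j _; rewrite mulr_ge0 ?exprn_ge0.
  move/allP => /(_ i (mem_index_enum i)).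
  rewrite /= mulf_eq0 expf_eq0 /= normr_eq0.
  by case/orP => /eqP ->; rewrite ?mul0r ?mulr0.
have Ey0 : diag_mx E *m y = 0.
  by apply/colP => i; rewrite mul_diag_mx mxE Ey mxE.
have : (toC a *: 1%:M - map_mx toC A) *m xC = 0.
  by rewrite eqE -!mulmxA -/y Ey0 mulmx0.
rewrite -(map_mx1 toC) -map_mxZ -map_mxB -map_mxM mulmxBl -scalemxAl mul1mx.
rewrite -(map_mx0 toC) => /(map_mx_inj (f := toC)) /eqP.
by rewrite subr_eq0 => /eqP.
Qed.

End RealSymmetric.

(** * Distances and walks *)

Section Distance.
Variables (T : finType) (e : rel T).

Lemma walkP k x y :
  reflect (exists s : seq T, [/\ size s = k, path e x s & last x s = y])
          (walk e k x y).
Proof.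
apply: (iffP existsP) => [[s /andP[es /eqP ls]]|[s [sz es ls]]].
  by exists s; rewrite size_tuple.
move/eqP: sz => sz; exists (Tuple sz) => /=.
by rewrite es ls eqxx.
Qed.

Lemma walk0 x y : walk e 0 x y = (x == y).
Proof.
apply/walkP/eqP => [[s [/eqP]]|->]; last by exists [::].
by rewrite size_eq0 => /eqP ->.
Qed.

Lemma walkS k x y : walk e k.+1 x y = [exists z, e x z && walk e k z y].
Proof.
apply/walkP/existsP => [[[|z s] [] //= [sz] /andP[exz es] ls]|].
  by exists z; rewrite exz; apply/walkP; exists s.
case=> z /andP[exz /walkP[s [sz es ls]]].
by exists (z :: s); rewrite /= sz exz es.
Qed.

Lemma walk1 x y : walk e 1 x y = e x y.
Proof.
rewrite walkS; apply/existsP/idP => [[z /andP[exz]]|exy].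
  by rewrite walk0 => /eqP <-.
by exists y; rewrite exy walk0 /=.
Qed.

(** The search for [gdist] stops before [#|T|], but this is no restriction on
    [k]: the value of [gdist] is at most [#|T|]. *)
Lemma walk_lt_gdist k x y : (k < gdist e x y)%N -> ~~ walk e k x y.
Proof.
move=> ltk; have kT : (k < #|T|)%N.
  by apply: leq_trans ltk _; rewrite -[leqRHS](size_iota 0) find_size.
by have := before_find 0%N ltk; rewrite nth_iota // add0n => ->.
Qed.

Lemma gdist_le_walk k x y : walk e k x y -> (gdist e x y <= k)%N.
Proof. by apply: contraTT; rewrite -ltnNge; exact: walk_lt_gdist. Qed.

Hypothesis conn_e : connected_graph e.

Lemma walk_gdist x y : walk e (gdist e x y) x y.
Proof.
have /connectP[s es ->] := conn_e.2 x y.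
case/shortenP: es => s' es' us' _.
have lts' : (size s' < #|T|)%N.
  by have := max_card (mem (x :: s')); rewrite (card_uniqP us').
have has_walk : has (fun k => walk e k x (last x s')) (iota 0 #|T|).
  apply/hasP; exists (size s'); first by rewrite mem_iota.
  by apply/walkP; exists s'.
have := nth_find 0%N has_walk; rewrite nth_iota // -/(gdist _ _ _) //.
by rewrite -[X in (_ < X)%N](size_iota 0) -has_find.
Qed.

Lemma gdist_eq0 x y : (gdist e x y == 0%N) = (x == y).
Proof.
rewrite -walk0; apply/eqP/idP => [<-|/gdist_le_walk]; first exact: walk_gdist.
by rewrite leqn0 => /eqP.
Qed.

Lemma gdist_eq1 x y : irreflexive e -> (gdist e x y == 1%N) = e x y.
Proof.
move=> irr; rewrite -walk1; apply/eqP/idP => [<-|]; first exact: walk_gdist.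
move=> w1; apply/eqP; rewrite eqn_leq gdist_le_walk // lt0n gdist_eq0.
by apply: contraTneq w1 => ->; rewrite walk1 irr.
Qed.

End Distance.

(** * Distance matrices and powers of the adjacency matrix *)

Definition distmx (R : realType) (T : finType) (e : rel T) (i : nat) :
  'M[R]_#|T| :=
  \matrix_(x, y) (gdist e (enum_val x) (enum_val y) == i)%:R.

Definition distance_constant (R : realType) (T : finType) (e : rel T)
    (M : 'M[R]_#|T|) : Prop :=
  forall x y x' y',
    gdist e (enum_val x) (enum_val y) = gdist e (enum_val x') (enum_val y') ->
    M x y = M x' y'.

Section Adjacency.
Variables (R : realType) (T : finType) (e : rel T).
Hypotheses (simple_e : simple_graph e) (conn_e : connected_graph e).
Local Notation n := #|T|.
Local Notation A := (adjmx R e).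
Local Notation D := (distmx R e).
Local Notation dist x y := (gdist e (enum_val x) (enum_val y)).

Lemma adjmx_sym : A^T = A.
Proof. by apply/matrixP => x y; rewrite !mxE simple_e.1. Qed.

(** The witness [N] is the number of walks of length [k] from [x] to [y]. *)
Lemma adjmxXn_walk k x y :
  exists2 N : nat, (A ^+ k) x y = N%:R
                 & (0 < N)%N = walk e k (enum_val x) (enum_val y).
Proof.
elim: k x => [|k IHk] x.
  exists (x == y); first by rewrite expr0 mxE.
  by rewrite lt0b walk0 (inj_eq enum_val_inj).
have [N NE Nw] := fin_all_exists2 IHk.
exists (\sum_z e (enum_val x) (enum_val z) * N z)%N.
  rewrite exprS mxE natr_sum; apply: eq_bigr => z _.
  by rewrite mxE NE natrM.
rewrite lt0n sum_nat_eq0 negb_forall walkS.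
apply/existsP/existsP => -[z].
  rewrite muln_eq0 negb_or eqb0 negbK -lt0n Nw => w.
  by exists (enum_val z).
move=> w; exists (enum_rank z).
by rewrite /= muln_eq0 negb_or eqb0 negbK -lt0n Nw enum_rankK.
Qed.

(** Terms of degree [k] count walks of length [k], and there are none below the
    distance. *)
Lemma mx_eval_far (f : {poly R}) x y :
  (size f <= dist x y)%N -> mx_eval A f x y = 0.
Proof.
move=> szf; rewrite /mx_eval summxE big1 // => k _; rewrite mxE.
have [N -> Nw] := adjmxXn_walk k x y.
have /negPf := walk_lt_gdist (leq_trans (ltn_ord k) szf).
by rewrite -Nw; case: N {Nw} => // _; rewrite mulr0.
Qed.

(** Only the leading term contributes, and it counts shortest paths. *)
Lemma mx_eval_at_dist (f : {poly R}) x y :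
  size f = (dist x y).+1 -> f \is monic ->
  exists2 N : nat, mx_eval A f x y = N%:R & (0 < N)%N.
Proof.
move=> szf monf; have [N NE Nw] := adjmxXn_walk (dist x y) x y.
exists N; last by rewrite Nw walk_gdist.
have lead1 : f`_(dist x y) = 1 by rewrite -[RHS](monicP monf) lead_coefE szf.
rewrite -NE /mx_eval szf big_ord_recr /= lead1 scale1r mxE.
rewrite summxE big1 ?add0r // => k _; rewrite mxE.
have [m -> mw] := adjmxXn_walk k x y.
have /negPf := walk_lt_gdist (ltn_ord k).
by rewrite -mw; case: m {mw} => // _; rewrite mulr0.
Qed.

Lemma distmx0 : D 0 = 1%:M.
Proof.
by apply/matrixP => x y; rewrite !mxE gdist_eq0 // (inj_eq enum_val_inj).
Qed.

Lemma distmx1 : D 1 = A.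
Proof. by apply/matrixP => x y; rewrite !mxE gdist_eq1 //; case: simple_e. Qed.

(** The number of vertices at distance [i] from [u] and [j] from [v] is the
    entry of [D i *m D j] at [u, v]. *)
Lemma distance_regular_of_algebra :
  (forall i, exists f, mx_eval A f = D i) ->
  (forall f, distance_constant e (mx_eval A f)) -> distance_regular e.
Proof.
move=> polyD constA; split=> // h i j u v u' v' duv duv'.
have count x y : (D i *m D j) (enum_rank x) (enum_rank y) =
    #|[set w | (gdist e x w == i) && (gdist e y w == j)]|%:R :> R.
  have [f fE] := polyD j.
  have symD : (D j)^T = D j by rewrite -fE mx_eval_sym // adjmx_sym.
  rewrite -[D j in LHS]symD mxE -sum1_card natr_sum [RHS]big_mkcond /=.
  rewrite [RHS](reindex (@enum_val T predT)) /=; last first.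
    by apply: onW_bij; exact: enum_val_bij.
  apply: eq_bigr => w _; rewrite !mxE !enum_rankK inE -natrM mulnb.
  by case: (_ && _).
have [f fE] := polyD i; have [g gE] := polyD j.
apply/eqP; rewrite -(eqr_nat R) -!count -fE -gE -mx_evalM; apply/eqP.
by apply: constA; rewrite !enum_rankK duv duv'.
Qed.

End Adjacency.

(** * Predistance polynomials *)

Section Predistance.
Variables (R : realType) (T : finType) (e : rel T).
Hypotheses (simple_e : simple_graph e) (conn_e : connected_graph e).
Local Notation n := #|T|.
Local Notation A := (adjmx R e).
Local Notation D := (distmx R e).
Local Notation dist x y := (gdist e (enum_val x) (enum_val y)).
Local Notation one := (const_mx 1 : 'cV[R]_n).

Lemma natr_card_neq0 : n%:R != 0 :> R.
Proof. by rewrite pnatr_eq0 -lt0n; case: conn_e. Qed.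

Lemma graph_innerE (f g : {poly R}) :
  graph_inner e f g =
  n%:R^-1 * \sum_x \sum_y mx_eval A f x y * mx_eval A g x y.
Proof.
congr (_ * _); rewrite /mxtrace; apply: eq_bigr => x _; rewrite mxE.
apply: eq_bigr => y _; congr (_ * _).
by rewrite -[in LHS](mx_eval_sym _ (adjmx_sym R simple_e)) mxE.
Qed.

(** In an [a]-regular graph [x^T (a - A) x] is the sum of [(x_u - x_v)^2] over
    the edges, so an eigenvector for the valency is constant along edges, hence
    constant. *)
Lemma regular_eigenvector_const (a : R) (x : 'cV[R]_n) :
  A *m one = a *: one -> A *m x = a *: x -> forall i j, x i 0 = x j 0.
Proof.
move=> Aone Ax.
have row_sum i : \sum_j A i j = a.
  move/colP: Aone => /(_ i); rewrite !mxE mulr1 => <-.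
  by apply: eq_bigr => j _; rewrite [const_mx _ _ _]mxE mulr1.
have col_sum j : \sum_i A i j = a.
  rewrite -(row_sum j); apply: eq_bigr => i _.
  by rewrite -[in LHS](adjmx_sym R simple_e) mxE.
have Axi i : \sum_j A i j * x j 0 = a * x i 0.
  by move/colP: Ax => /(_ i); rewrite !mxE.
have sum0 : \sum_i \sum_j A i j * (x i 0 - x j 0) ^+ 2 = 0.
  transitivity (\sum_i \sum_j A i j * x i 0 ^+ 2 +
                \sum_i \sum_j A i j * x j 0 ^+ 2 -
                \sum_i x i 0 * (\sum_j A i j * x j 0) *+ 2).
    rewrite -big_split -sumrB /=; apply: eq_bigr => i _.
    rewrite mulr_sumr -sumrMnl -big_split -sumrB /=; apply: eq_bigr => j _.
    ring.
  rewrite [X in _ + X - _]exchange_big /=.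
  rewrite -big_split -sumrB /= big1 // => i _.
  by rewrite -!mulr_suml row_sum col_sum Axi; ring.
have A_ge0 i j : 0 <= A i j by rewrite mxE ler0n.
have edge i j : e (enum_val i) (enum_val j) -> x i 0 = x j 0.
  move=> eij; move/eqP: sum0; rewrite psumr_eq0; last first.
    by move=> k _; apply: sumr_ge0 => l _; rewrite mulr_ge0 ?sqr_ge0.
  move/allP => /(_ i (mem_index_enum i)) /=; rewrite psumr_eq0; last first.
    by move=> l _; rewrite mulr_ge0 ?sqr_ge0.
  move/allP => /(_ j (mem_index_enum j)) /=.
  by rewrite mxE eij mul1r sqrf_eq0 subr_eq0 => /eqP.
move=> i j; have /connectP[s] := conn_e.2 (enum_val i) (enum_val j).
elim: s i => [|z s IHs] i /=; first by move=> _ /enum_val_inj ->.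
move=> /andP[ez es] ls; rewrite (edge i (enum_rank z)) ?enum_rankK //.
by apply: IHs; rewrite enum_rankK.
Qed.

Variables (d : nat) (lambda : 'I_d.+1 -> R) (p : 'I_d.+1 -> {poly R}).
Hypotheses (eig_lambda : distinct_eigenvalues e lambda)
           (predist_p : predistance_polynomials e lambda p).

Lemma predistance0 : p ord0 = 1.
Proof.
have [szp _ normp] := predist_p.
have /size_poly1P[c c0 pc] : size (p ord0) == 1%N by rewrite szp.
have := normp ord0; rewrite pc hornerC /graph_inner mx_evalC.
rewrite -scalar_mxM mxtrace_scalar -(mulr_natl (c * c)).
rewrite mulKf ?natr_card_neq0 //.
by rewrite -[RHS]mulr1 => /(mulfI c0) ->.
Qed.

Lemma trace_adjmx : \tr A = 0.
Proof. by rewrite /mxtrace big1 // => i _; rewrite mxE simple_e.2. Qed.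

(** The constant coefficient of [p_1] is its inner product with [p_0 = 1], as
    [A] has trace [0]. *)
Lemma predistance1 (i : 'I_d.+1) : i = 1%N :> nat -> p i \is monic -> p i = 'X.
Proof.
move=> i1 mon; have [szp orthp _] := predist_p.
have pE : p i = 'X + ((p i)`_0)%:P.
  apply/polyP => -[|[|k]]; rewrite coefD coefX coefC /= ?add0r ?addr0 //.
    by rewrite -(monicP mon) lead_coefE szp i1.
  by rewrite nth_default // szp i1.
have := orthp i ord0; rewrite -(inj_eq val_inj) /= i1 => /(_ isT).
rewrite predistance0 /graph_inner pE mx_evalD mx_evalX !mx_evalC mulmx1.
rewrite raddfD /= trace_adjmx add0r mxtrace_scalar.
by rewrite -(mulr_natl (p i)`_0) mulKf ?natr_card_neq0 // => ->; rewrite addr0.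
Qed.

Lemma lambda0_max a : eigenvalue A a -> a <= lambda ord0.
Proof.
have [dec eigP] := eig_lambda.
case/eigP => i ->; have [->//|i0] := eqVneq i ord0.
by apply/ltW/dec; rewrite lt0n.
Qed.

(** When [p_1 = 'X], its normalization says that the average valency
    [\tr (A ^+ 2) / n] equals the largest eigenvalue; so the all-one vector
    attains the maximum of the Rayleigh quotient. *)
Lemma predistance1_regular (i : 'I_d.+1) :
  i = 1%N :> nat -> p i \is monic -> A *m one = lambda ord0 *: one.
Proof.
move=> i1 mon; have [_ _ normp] := predist_p.
have := normp i; rewrite (predistance1 i1 mon) hornerX => normX.
apply: symmetric_max_rayleigh; [exact: adjmx_sym | exact: lambda0_max |].
have sqA x y : A x y * A x y = A x y.
  by rewrite mxE; case: (e _ _); rewrite ?mulr1 ?mulr0.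
have sumA : \sum_x \sum_y A x y = lambda ord0 * n%:R.
  rewrite -normX graph_innerE mulrC mulrA divff ?natr_card_neq0 // mul1r.
  by apply: eq_bigr => x _; apply: eq_bigr => y _; rewrite mx_evalX sqA.
apply/matrixP => k l; rewrite !ord1 {k l}.
transitivity (\sum_x \sum_y A x y).
  rewrite mxE exchange_big; apply: eq_bigr => y _; rewrite !mxE mulr1.
  by apply: eq_bigr => x _; rewrite !mxE mul1r.
rewrite sumA !mxE; congr (_ * _).
rewrite -[LHS]mulr1 -[n in LHS]card_ord -sum1_card natr_sum mulr_suml.
by apply: eq_bigr => x _; rewrite !mxE mulr1.
Qed.

(** This is the heart of the proof. Put [M = p_i(A)]. Entries at distance
    greater than [i] vanish by degree, entries at a distance [j < i] sum to
    [0] by orthogonality to [p_j(A) = D j], and all entries sum to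
    [n * p_i(lambda_0)] by regularity; by normalization this is also the sum
    of the squares of all entries. So the squares of all entries have the same
    sum as the entries at distance [i]. As [p_i] is monic the latter are
    positive integers, which forces them to be [1] and all others to be [0]. *)
Lemma predistance_distmx (i : 'I_d.+1) :
  A *m one = lambda ord0 *: one ->
  p i \is monic -> (forall j : 'I_d.+1, (j < i)%N -> mx_eval A (p j) = D j) ->
  mx_eval A (p i) = D i.
Proof.
move=> reg mon IH; have [szp orthp normp] := predist_p.
set M := mx_eval A (p i).
have far x y : (i < dist x y)%N -> M x y = 0.
  by move=> lti; apply: mx_eval_far; rewrite ?szp.
have at_i x y : dist x y = i -> exists2 N : nat, M x y = N%:R & (0 < N)%N.
  by move=> Exy; apply: mx_eval_at_dist; rewrite ?Exy ?szp.
have orth (j : 'I_d.+1) : (j < i)%N -> \sum_x \sum_y M x y * D j x y = 0.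
  move=> ltj; have neq_ij : i != j by apply: contraTneq ltj => ->; rewrite ltnn.
  have := orthp i j neq_ij; rewrite graph_innerE (IH j ltj) => /eqP.
  by rewrite mulf_eq0 invr_eq0 (negPf natr_card_neq0) => /eqP.
have sumM : \sum_x \sum_y M x y = \sum_x \sum_y M x y ^+ 2.
  transitivity ((p i).[lambda ord0] * n%:R).
    rewrite mulr_natr -[n in RHS]card_ord -sumr_const; apply: eq_bigr => x _.
    have /colP/(_ x) := mx_eval_eigenvector (p i) reg.
    rewrite !mxE mulr1 => <-.
    by apply: eq_bigr => y _; rewrite [const_mx _ _ _]mxE mulr1.
  rewrite -normp graph_innerE mulrC mulrA divff ?natr_card_neq0 // mul1r.
  by apply: eq_bigr => x _; apply: eq_bigr => y _; rewrite expr2.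
have sumMi : \sum_x \sum_y M x y * D i x y = \sum_x \sum_y M x y.
  (* among the [D j] with [j <= i] exactly one is [1] at an entry of [M] that
     may be nonzero *)
  have split_M x y : M x y = \sum_(j < i.+1) M x y * D j x y.
    rewrite -mulr_sumr; have [lti|gti] := ltnP i (dist x y).
      by rewrite far // mul0r.
    rewrite (bigD1 (Ordinal (gti : (dist x y < i.+1)%N))) //= !mxE eqxx.
    rewrite big1 ?addr0 ?mulr1 // => j; rewrite -(inj_eq val_inj) /= mxE.
    by rewrite eq_sym => /negPf ->.
  transitivity (\sum_(j < i.+1) \sum_x \sum_y M x y * D j x y).
    rewrite big_ord_recr /= [X in X + _]big1 ?add0r // => j _.
    by apply: (orth (Ordinal (ltn_trans (ltn_ord j) (ltn_ord i)))) => /=.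
  rewrite exchange_big; apply: eq_bigr => x _ /=.
  by rewrite exchange_big; apply: eq_bigr => y _ /=; rewrite -split_M.
have sum0 : \sum_x \sum_y (M x y ^+ 2 - M x y * D i x y) = 0.
  under eq_bigr do rewrite sumrB.
  by rewrite sumrB sumMi sumM subrr.
have term_ge0 x y : 0 <= M x y ^+ 2 - M x y * D i x y.
  rewrite [D i x y]mxE; case: eqP => [/at_i[N -> N0]|_]; last first.
    by rewrite mulr0 subr0 sqr_ge0.
  by rewrite mulr1 subr_ge0 -natrX ler_nat expnS expn1 leq_pmulr.
apply/matrixP => x y; move/eqP: sum0; rewrite psumr_eq0; last first.
  by move=> k _; apply: sumr_ge0.
move/allP => /(_ x (mem_index_enum x)) /=; rewrite psumr_eq0 //.
move/allP => /(_ y (mem_index_enum y)) /=; rewrite [D i x y]mxE.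
case: (dist x y =P i) => [/at_i[N -> N0]|_].
  have -> : N%:R ^+ 2 - N%:R * 1 = N%:R * (N%:R - 1) :> R by ring.
  by rewrite mulf_eq0 subr_eq0 pnatr_eq0 eqn0Ngt N0 => /eqP.
by rewrite mulr0 subr0 sqrf_eq0 => /eqP.
Qed.

(** * Reduction to degree at most [d] *)

Definition eigen_prod : {poly R} := \prod_i ('X - (lambda i)%:P).

Lemma eigen_prod_annihilates : mx_eval A eigen_prod = 0.
Proof.
apply: symmetric_annihilated => [|a]; first exact: adjmx_sym.
case/eig_lambda.2 => i ->.
by rewrite /eigen_prod (bigD1 i) //= rootM root_XsubC eqxx.
Qed.

(** [A] being diagonalizable, its minimal polynomial has degree [d.+1]. *)
Lemma mx_eval_small (f : {poly R}) :
  exists2 g : {poly R}, (size g <= d.+1)%N & mx_eval A f = mx_eval A g.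
Proof.
have mon : eigen_prod \is monic by exact: monic_prod_XsubC.
exists (f %% eigen_prod).
  rewrite -ltnS -(card_ord d.+1) cardE -(size_prod_XsubC _ lambda).
  by rewrite big_enum ltn_modp monic_neq0.
rewrite {1}(divp_eq f eigen_prod) mx_evalD mx_evalM eigen_prod_annihilates.
by rewrite mulmx0 add0r.
Qed.

(** At distance [k] the matrix [A ^+ k] has a nonzero entry, whereas polynomials
    of degree at most [d], which represent all polynomials in [A], vanish at
    distances greater than [d]. *)
Lemma gdist_le_degree (x y : 'I_n) : (dist x y <= d)%N.
Proof.
rewrite leqNgt; apply/negP => ltd.
have [g szg] := mx_eval_small 'X^(dist x y).
have [N] := @mx_eval_at_dist R _ _ conn_e 'X^(dist x y) x y
  (size_polyXn _ _) (monicXn _ _).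
move=> NE N0 Eg; move: NE; rewrite Eg mx_eval_far ?(leq_trans szg) //.
by move/eqP; rewrite eq_sym pnatr_eq0 eqn0Ngt N0.
Qed.

(** The [r k] form a basis of the polynomials of degree at most [d], because
    their degrees are [0, ..., d]. *)
Lemma distance_constant_spanned (r : nat -> {poly R}) :
  (forall k, (k <= d)%N -> size (r k) = k.+1) ->
  (forall k, (k <= d)%N -> distance_constant e (mx_eval A (r k))) ->
  forall f, distance_constant e (mx_eval A f).
Proof.
move=> szr constr f; have [g szg ->] := mx_eval_small f.
suff H k : (k <= d.+1)%N -> forall h : {poly R}, (size h <= k)%N ->
    distance_constant e (mx_eval A h) by exact: (H d.+1).
elim: k => [|k IHk] lek h szh x y x' y' Exy.
  move: szh; rewrite leqn0 size_poly_eq0 => /eqP ->.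
  by rewrite mx_eval0 !mxE.
set c := h`_k / lead_coef (r k).
have szrk := szr k lek.
have rk0 : lead_coef (r k) != 0 by rewrite lead_coef_eq0 -size_poly_eq0 szrk.
rewrite -(subrK (c *: r k) h) mx_evalD mx_evalZ !mxE.
rewrite (constr k lek _ _ _ _ Exy); congr (_ + _).
apply: IHk (ltnW lek) _ _ _ _ _ _ Exy; apply/leq_sizeP => j lej.
rewrite coefB coefZ; have [->|neq] := eqVneq j k.
  have -> : (r k)`_k = lead_coef (r k) by rewrite lead_coefE szrk.
  by rewrite /c divfK ?subrr.
have ltj : (k < j)%N by rewrite ltn_neqAle eq_sym neq.
by rewrite !nth_default ?mulr0 ?subrr // (szrk, leq_trans szh).
Qed.

(** The polynomial vanishing at every eigenvalue other than [lambda_0] maps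
    the adjacency matrix of a connected regular graph to a nonzero multiple of
    the all-one matrix, since its columns are eigenvectors for [lambda_0]
    (Hoffman). *)
Lemma hoffman_polynomial :
  A *m one = lambda ord0 *: one ->
  exists q : {poly R}, size q = d.+1 /\ mx_eval A q = const_mx 1.
Proof.
move=> reg; set q := \prod_(i | i != ord0) ('X - (lambda i)%:P).
have eqm : eigen_prod = ('X - (lambda ord0)%:P) * q.
  by rewrite /eigen_prod (bigD1 ord0).
have szq : size q = d.+1.
  have : size eigen_prod = d.+2.
    by rewrite /eigen_prod -big_enum size_prod_XsubC -cardE card_ord.
  have monq : q \is monic by apply: monic_prod => i _; exact: monicXsubC.
  by rewrite eqm size_Mmonic ?polyXsubC_eq0 // size_XsubC /= => -[].
have q0 : q.[lambda ord0] != 0.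
  rewrite horner_prod prodf_seq_neq0; apply/allP => i _; apply/implyP => i0.
  rewrite hornerXsubC subr_eq0 gt_eqF // eig_lambda.1 //.
  by rewrite lt0n.
set Q := mx_eval A q.
have AQ : A *m Q = lambda ord0 *: Q.
  have := eigen_prod_annihilates; rewrite eqm mx_evalM mx_evalD mx_evalX.
  rewrite -polyCN mx_evalC mulmxDl mul_scalar_mx scaleNr => /eqP.
  by rewrite subr_eq0 => /eqP.
have colQ j x y : Q x j = Q y j.
  have : A *m col j Q = lambda ord0 *: col j Q.
    by rewrite !colE mulmxA AQ -scalemxAl.
  by move/(regular_eigenvector_const reg)/(_ x y); rewrite !mxE.
have symQ x y : Q x y = Q y x.
  by have /matrixP/(_ y x) := mx_eval_sym q (adjmx_sym R simple_e); rewrite mxE.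
have constQ x y x' y' : Q x y = Q x' y'.
  by rewrite (colQ y x y') symQ; exact: colQ.
have /card_gt0P[t _] := conn_e.1; set x0 := enum_rank t.
have c0 : Q x0 x0 != 0.
  apply: contraNneq q0 => c0.
  have /colP/(_ x0) := mx_eval_eigenvector q reg.
  rewrite !mxE mulr1 => <-; rewrite big1 // => j _.
  by rewrite (constQ _ _ x0 x0) c0 mul0r.
exists ((Q x0 x0)^-1 *: q); rewrite size_scale ?invr_eq0 //; split=> //.
by apply/matrixP => x y; rewrite mx_evalZ !mxE (constQ x y x0 x0) mulVf.
Qed.

(** * Distance-regularity *)

(** Distances are at most [d], and so are degrees after reduction modulo the
    minimal polynomial; hence both conditions are only required up to [d]. *)
Lemma distance_regular_of_basis (r : nat -> {poly R}) :
  (forall k, (k <= d)%N -> exists f, mx_eval A f = D k) ->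
  (forall k, (k <= d)%N -> size (r k) = k.+1) ->
  (forall k, (k <= d)%N -> distance_constant e (mx_eval A (r k))) ->
  distance_regular e.
Proof.
move=> polyD szr constr.
apply: (@distance_regular_of_algebra R) => //; last first.
  exact: distance_constant_spanned constr.
move=> k; have [/polyD//|ltd] := leqP k d; exists 0.
rewrite mx_eval0; apply/matrixP => x y; rewrite !mxE.
by rewrite ltn_eqF // (leq_ltn_trans (gdist_le_degree x y)).
Qed.

Lemma distance_constant_distmx k : distance_constant e (D k).
Proof. by move=> x y x' y' Exy; rewrite !mxE Exy. Qed.

(** Here [1] and [A] are [D 0] and [D 1], and there are no other distances. *)
Lemma distance_regular_small : (d <= 1)%N -> distance_regular e.
Proof.
move=> d1; have DX k : (k <= d)%N -> mx_eval A 'X^k = D k.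
  move=> /leq_trans/(_ d1); case: k => [_|[_|//]].
    by rewrite mx_evalXn expr0 distmx0.
  by rewrite mx_evalXn expr1 distmx1.
apply: (@distance_regular_of_basis (fun k => 'X^k)) => k lek.
- by exists 'X^k; exact: DX.
- by rewrite size_polyXn.
- by rewrite DX //; exact: distance_constant_distmx.
Qed.

Lemma predistance_monic_distmx :
  (forall i : 'I_d.+1, (1 <= i <= d.-1)%N -> p i \is monic) ->
  A *m one = lambda ord0 *: one ->
  forall i : 'I_d.+1, (i < d)%N -> mx_eval A (p i) = D i.
Proof.
move=> mon reg i; have [k] := ubnP (i : nat).
elim: k i => // k IHk i; rewrite ltnS => lek ltd.
have [i0|i_gt0] := posnP i.
  have -> : i = ord0 by apply: val_inj.
  by rewrite predistance0 mx_evalC distmx0.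
apply: predistance_distmx => //.
  by apply: mon; rewrite i_gt0 -ltnS prednK // (leq_ltn_trans _ ltd).
move=> j ltj; apply: IHk; first exact: leq_trans ltj lek.
exact: ltn_trans ltj ltd.
Qed.

Lemma monic_predistance_distance_regular :
  (forall i : 'I_d.+1, (1 <= i <= d.-1)%N -> p i \is monic) ->
  distance_regular e.
Proof.
move=> mon; have [/distance_regular_small//|d_gt1] := leqP d 1.
have [szp _ _] := predist_p.
have reg : A *m one = lambda ord0 *: one.
  have lt1 : (1 < d.+1)%N by apply: leq_trans d_gt1 _.
  apply: (@predistance1_regular (Ordinal lt1)) => //; apply: mon => /=.
  by rewrite -ltnS prednK // ltnW.
have pD := predistance_monic_distmx mon reg.
have [q [szq qJ]] := hoffman_polynomial reg.
pose r k := if (k < d)%N then p (inord k) else q.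
have rD k : (k < d)%N -> mx_eval A (r k) = D k.
  by move=> ltd; rewrite /r ltd pD inordK // ltnW.
have sumD x y : \sum_(k < d.+1) D k x y = 1.
  have led : (dist x y < d.+1)%N := gdist_le_degree x y.
  rewrite (bigD1 (Ordinal led)) //= mxE eqxx big1 ?addr0 // => k.
  by rewrite -(inj_eq val_inj) mxE eq_sym /= => /negPf ->.
apply: (@distance_regular_of_basis r) => k; rewrite leq_eqVlt.
- case/predU1P => [->|ltd]; last by exists (r k); exact: rD.
  (* the distance matrices sum to the all-one matrix [q(A)] *)
  exists (q - \sum_(j < d) r j).
  rewrite mx_evalD -scaleN1r mx_evalZ scaleN1r mx_eval_sum qJ.
  apply/matrixP => x y; rewrite mxE [X in X + _]mxE [X in _ + X]mxE summxE.
  rewrite (eq_bigr (fun j : 'I_d => D j x y)) => [|j _]; last by rewrite rD.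
  rewrite -(sumD x y) big_ord_recr /=.
  by rewrite addrAC subrr add0r.
- case/predU1P => [->|ltd]; first by rewrite /r ltnn.
  by rewrite /r ltd szp inordK // ltnW.
- case/predU1P => [->|ltd]; last first.
    by rewrite rD //; exact: distance_constant_distmx.
  by rewrite /r ltnn qJ => x y x' y' _; rewrite !mxE.
Qed.

End Predistance.

Unset Implicit Arguments.

Theorem theorem5p7 (R : realType) (T : finType) (e : rel T)
    (d : nat) (lambda : 'I_d.+1 -> R) (p : 'I_d.+1 -> {poly R})
    (simple_e : simple_graph e) (conn_e : connected_graph e)
    (eig_lambda : distinct_eigenvalues e lambda)
    (predist_p : predistance_polynomials e lambda p) :
  ((forall i : 'I_d.+1, (1 <= i <= d.-1)%N -> p i \is monic) ->
     distance_regular e) /\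
  (bipartite e -> (forall i : 'I_d.+1, p i \is monic) ->
     distance_regular e).
Proof.
have main := monic_predistance_distance_regular
  simple_e conn_e eig_lambda predist_p.
by split=> [|_ mon]; [exact: main | apply: main => i _; exact: mon].
Qed.
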